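(* Let $\mathfrak R$ be a topologically semiperfect topological ring. Then each lattice-finite left $\mathfrak R$-contramodule has a projective cover in both the abelian category of left $\mathfrak R$-contramodules and the abelian category of left $\mathfrak R$-modules (in the latter case, the underlying left $\mathfrak R$-module is meant).
   Context: All rings are associative and unital. All topological rings are complete, separated and right linear: open right ideals $\mathfrak I$ form a base of neighborhoods of zero and $\mathfrak R\to\varprojlim_{\mathfrak I}\mathfrak R/\mathfrak I$ is bijective. A family $(r_x)_{x\in X}$ in $\mathfrak R$ is zero-convergent if every open right ideal contains $r_x$ for all but finitely many $x$; infinite sums of zero-convergent families are limits of finite partial sums. A nonzero ring is local if its noninvertible elements form an additive subgroup. $\mathfrak R$ is topologically semiperfect if there exist a set $Z$ and a zero-convergent family $(e_z)_{z\in Z}$ of pairwise orthogonal idempotents in $\mathfrak R$ with $\sum_{z\in Z}e_z=1$ such that every ring $e_z\mathfrak R e_z$ is local. Contramodules: for a set $X$, $\mathfrak R[[X]]$ is the set of formal sums $\sum_{x\in X}r_xx$ with $(r_x)$ a zero-convergent family in $\mathfrak R$. For a map $f:X\to Y$, $\mathfrak R[[f]]$ sends $\sum_x r_xx$ to $\sum_y\bigl(\sum_{f(x)=y}r_x\bigr)y$. The functor $X\mapsto\mathfrak R[[X]]$ is a monad on sets, with unit $\epsilon_X:x\mapsto 1\cdot x$ and multiplication $\phi_X:\mathfrak R[[\mathfrak R[[X]]]]\to\mathfrak R[[X]]$, $\sum_i r_i\bigl(\sum_x s_{i,x}x\bigr)\mapsto\sum_x\bigl(\sum_i r_is_{i,x}\bigr)x$.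 A left $\mathfrak R$-contramodule is an algebra over this monad, i.e. a set $\mathfrak C$ with a contraaction map $\pi_{\mathfrak C}:\mathfrak R[[\mathfrak C]]\to\mathfrak C$ such that $\pi_{\mathfrak C}\circ\mathfrak R[[\pi_{\mathfrak C}]]=\pi_{\mathfrak C}\circ\phi_{\mathfrak C}$ and $\pi_{\mathfrak C}\circ\epsilon_{\mathfrak C}=\mathrm{id}$; morphisms are morphisms of algebras over the monad. Left $\mathfrak R$-contramodules form an abelian category with products, coproducts and enough projectives; restricting the contraaction to finite formal sums gives every contramodule an underlying left $\mathfrak R$-module structure. For $c_x\in\mathfrak C$ and a zero-convergent family $(r_x)_{x\in X}$, $\sum_xr_xc_x\in\mathfrak C$ denotes the image of $\sum_x r_xx$ under $\mathfrak R[[X]]\to\mathfrak R[[\mathfrak C]]\to\mathfrak C$. A subcontramodule is a subset $\mathfrak D\subset\mathfrak C$ to which the contraaction restricts as a map $\mathfrak R[[\mathfrak D]]\to\mathfrak D$. For a family of subcontramodules $\mathfrak C_x\subset\mathfrak C$, $x\in X$, put $\sum_{x\in X}\mathfrak C_x=\{\sum_{x\in X}r_xc_x: c_x\in\mathfrak C_x,\ (r_x)_{x\in X}\text{ zero-convergent in }\mathfrak R\}$ (the join in the lattice of subcontramodules). $\mathfrak C$ is lattice-finite if whenever $\sum_{x\in X}\mathfrak C_x=\mathfrak C$ for a family of subcontramodules, there is a finite subset $F\subset X$ with $\sum_{x\in F}\mathfrak C_x=\mathfrak C$. A projective cover of an object $C$ in an abelian category is an epimorphism $p:P\to C$ with $P$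 projective and superfluous kernel (equivalently, such that every endomorphism $f$ of $P$ with $pf=p$ is invertible). *)

(* Defs.v *)
From HB Require Import structures.
From mathcomp Require Import all_boot all_order all_algebra finmap.
From mathcomp Require Import all_classical topology tvs.
From mathcomp.analysis.showcase Require Import summability.

Set Implicit Arguments.
Unset Strict Implicit.
Unset Printing Implicit Defensive.

Import GRing.Theory.

Local Open Scope classical_set_scope.
Local Open Scope ring_scope.

HB.mixin Record TopologicalZmodule_isTopologicalPzRing R
    & TopologicalZmodule R & GRing.PzRing R := {
  mul_continuous : continuous (fun x : R * R => x.1 * x.2) ;
}.

#[short(type="topologicalPzRingType")]
HB.structure Definition TopologicalPzRing :=
  {R of TopologicalZmodule R & GRing.PzRing R
        & TopologicalZmodule_isTopologicalPzRing R}.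

Definition right_ideal (R : pzRingType) (I : set R) : Prop :=
  [/\ I 0, forall x y, I x -> I y -> I (x - y) & forall x r, I x -> I (x * r)].

Definition open_right_ideal (R : topologicalPzRingType) (I : set R) : Prop :=
  open I /\ right_ideal I.

(* The last two fields are the injectivity and the surjectivity of the
   canonical map from R to the projective limit of the R / I, where I ranges
   over the open right ideals; an element of this limit is given by a choice
   of representatives a I of its components. *)
HB.mixin Record TopologicalPzRing_isCompleteRightLinear R
    & TopologicalPzRing R := {
  right_linear_topology : forall U : set R, nbhs 0 U ->
    exists2 I : set R, open_right_ideal I & I `<=` U ;
  right_linear_separated : forall x : R,
    (forall I : set R, open_right_ideal I -> I x) -> x = 0 ;
  right_linear_complete : forall a : set R -> R,
    (forall I J : set R, open_right_ideal I -> open_right_ideal J ->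
       J `<=` I -> I (a J - a I)) ->
    exists x : R, forall I : set R, open_right_ideal I -> I (x - a I) ;
}.

#[short(type="rlTopRingType")]
HB.structure Definition RightLinearTopRing :=
  {R of TopologicalPzRing R & TopologicalPzRing_isCompleteRightLinear R}.

Definition zero_convergent (R : topologicalPzRingType) (X : choiceType)
    (r : X -> R) : Prop :=
  forall I : set R, open_right_ideal I -> finite_set [set x | ~ I (r x)].

(* The limit of the finite partial sums if it exists, and 0 otherwise. *)
Definition tsum (R : topologicalPzRingType) (X : choiceType) (r : X -> R) : R :=
  xget 0 [set s | partial_sum r @ totally --> s].

Section InfiniteSums.
Variable R : rlTopRingType.
Implicit Types (X Y : choiceType) (I : set R).

Lemma right_idealN (I : set R) x : right_ideal I -> I x -> I (- x).
Proof. by case=> I0 IB _ Ix; rewrite -sub0r; exact: IB. Qed.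

Lemma right_idealD (I : set R) x y : right_ideal I -> I x -> I y -> I (x + y).
Proof.
move=> rI Ix Iy; rewrite -[y]opprK; case: (rI) => _ IB _.
by apply: IB => //; exact: right_idealN.
Qed.

Lemma right_ideal_sum (J : Type) (s : seq J) (P : pred J) (r : J -> R) I :
  right_ideal I -> (forall i, P i -> I (r i)) -> I (\sum_(i <- s | P i) r i).
Proof.
move=> rI Ir; apply: (big_ind I) => //; first by case: rI.
by move=> x y; exact: right_idealD.
Qed.

Lemma open_right_ideal_cap I J : open_right_ideal I -> open_right_ideal J ->
  open_right_ideal (I `&` J).
Proof.
move=> [oI [I0 IB IM]] [oJ [J0 JB JM]]; split; first exact: openI.
by split=> //= [x y [? ?] [? ?]|x r [? ?]]; split; auto.
Qed.

Lemma open_right_ideal_mulV (a : R) I :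
  open_right_ideal I -> open_right_ideal [set x | I (a * x)].
Proof.
move=> [oI [I0 IB IM]]; split; last first.
  split=> /= [|x y|x r]; first by rewrite mulr0.
  - by move=> ? ?; rewrite mulrBr; exact: IB.
  - by move=> ?; rewrite mulrA; exact: IM.
have ca : continuous (fun x : R => a * x).
  move=> x.
  apply: (@continuous_comp _ _ _ (fun x => (a, x)) (fun x : R * R => x.1 * x.2)).
    by apply: cvg_pair => /=; [exact: cvg_cst|exact: cvg_id].
  exact: mul_continuous.
by apply: (open_comp _ oI) => x _; exact: ca.
Qed.

Lemma cvg_partial_sumP X (r : X -> R) s :
  partial_sum r @ totally --> s <->
  (forall I, open_right_ideal I -> exists F : {fset X},
     forall G : {fset X}, (F `<=` G)%fset -> I (s - partial_sum r G)).
Proof.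
have cB : continuous (fun x : R => s - x).
  move=> x.
  apply: (@continuous_comp _ _ _ (fun x => (s, x)) (fun x : R * R => x.1 - x.2)).
    by apply: cvg_pair => /=; [exact: cvg_cst|exact: cvg_id].
  exact: sub_continuous.
split=> [rs I oI|rs U /= sU].
  have : nbhs s [set x | I (s - x)].
    apply: cB; rewrite subrr; apply: open_nbhs_nbhs; split; first by case: oI.
    by case: oI => _ [].
  by move/rs => [F _ FI]; exists F => G /FI.
have : nbhs (0 : R) [set x | U (s - x)].
  by apply: cB; rewrite subr0.
move=> /right_linear_topology[I oI IU].
have [F FI] := rs I oI; exists F => //= G /= /FI /IU /=.
by rewrite opprB addrC subrK.
Qed.

Lemma tsum_eq X (r : X -> R) s :
  (forall I, open_right_ideal I -> exists F : {fset X},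
     forall G : {fset X}, (F `<=` G)%fset -> I (s - partial_sum r G)) ->
  tsum r = s.
Proof.
move=> rs; apply: xget_unique; first exact/cvg_partial_sumP.
move=> t /cvg_partial_sumP rt; apply/eqP; rewrite -subr_eq0; apply/eqP.
apply: right_linear_separated => I oI.
have [F FI] := rs I oI; have [G GI] := rt I oI.
have := FI _ (fsubsetUl F G); have := GI _ (fsubsetUr F G).
case: oI => _ [_ IB _] h1 h2.
by have := IB _ _ h1 h2; rewrite opprB addrA subrK.
Qed.

Lemma partial_sumE X (r : X -> R) (F : {fset X}) :
  partial_sum r F = \sum_(x <- F) r x.
Proof. by rewrite /partial_sum big_seq_fsetE. Qed.

Lemma partial_sum_sub X (r : X -> R) I (F G : {fset X}) : right_ideal I ->
  (forall x, x \notin F -> I (r x)) -> (F `<=` G)%fset ->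
  I (partial_sum r G - partial_sum r F).
Proof.
move=> rI Ir FG; rewrite !partial_sumE (bigID (mem F))/=.
have -> : \sum_(x <- G | x \in F) r x = \sum_(x <- F) r x.
  rewrite -big_filter; apply: perm_big.
  apply: uniq_perm; rewrite ?filter_uniq ?fset_uniq// => x.
  by rewrite mem_filter/=; apply: andb_idr; exact: (fsubsetP FG).
by rewrite addrAC subrr add0r; exact: right_ideal_sum.
Qed.

Lemma tsum_cvg X (r : X -> R) : zero_convergent r ->
  forall I, open_right_ideal I -> exists F : {fset X},
     forall G : {fset X}, (F `<=` G)%fset -> I (tsum r - partial_sum r G).
Proof.
move=> zr.
pose S (I : set R) := fset_set [set x | ~ I (r x)].
have SP I x : open_right_ideal I -> x \notin S I -> I (r x).
  move=> oI; rewrite in_fset_set; last exact: zr.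
  by rewrite notin_setE/= => /contrapT.
have [|s sP] := right_linear_complete (fun I => partial_sum r (S I)).
  move=> I J oI oJ JI; apply: partial_sum_sub => [|x|]; first by case: oI.
    exact: SP.
  apply/fsubsetP => x; rewrite !in_fset_set; [|exact: zr..].
  by rewrite !in_setE/= => nI /JI.
have sE I : open_right_ideal I -> exists F : {fset X},
    forall G : {fset X}, (F `<=` G)%fset -> I (s - partial_sum r G).
  move=> oI; exists (S I) => G SG.
  have rI : right_ideal I by case: oI.
  rewrite -[s](subrK (partial_sum r (S I))) -addrA.
  apply: right_idealD => //; first exact: sP.
  rewrite -opprB; apply: right_idealN => //.
  by apply: partial_sum_sub => // x; exact: SP.
by rewrite (tsum_eq sE).
Qed.

Lemma tsum_mem X (r : X -> R) I : zero_convergent r -> open_right_ideal I ->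
  (forall x, I (r x)) -> I (tsum r).
Proof.
move=> zr oI Ir; have [F /(_ F (fsubset_refl F))] := tsum_cvg zr oI.
have rI : right_ideal I by case: oI.
have : I (partial_sum r F) by rewrite partial_sumE; exact: right_ideal_sum.
by move=> h1 h2; have := right_idealD rI h2 h1; rewrite subrK.
Qed.

Lemma zero_convergent0 X : zero_convergent (fun _ : X => 0 : R).
Proof.
move=> I [_ [I0 _ _]]; rewrite (_ : [set _ | _] = set0)//.
by apply/seteqP; split.
Qed.

Lemma zero_convergentD X (r s : X -> R) :
  zero_convergent r -> zero_convergent s -> zero_convergent (fun x => r x + s x).
Proof.
move=> zr zs I oI.
apply: (@sub_finite_set _ _ ([set x | ~ I (r x)] `|` [set x | ~ I (s x)])).
  move=> x /= rsI; apply: contrapT => /not_orP[/contrapT Ir /contrapT Is].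
  by apply: rsI; apply: right_idealD => //; case: oI.
by rewrite finite_setU; split; [exact: zr|exact: zs].
Qed.

Lemma zero_convergentMl X (a : R) (r : X -> R) :
  zero_convergent r -> zero_convergent (fun x => a * r x).
Proof. by move=> zr I /(open_right_ideal_mulV a) /zr. Qed.

Lemma zero_convergentMr X (r s : X -> R) :
  zero_convergent r -> zero_convergent (fun x => r x * s x).
Proof.
move=> zr I oI; apply: sub_finite_set (zr I oI) => x /=; apply: contra_not.
by case: oI => _ [_ _ IM] /IM; exact.
Qed.

Lemma tsum0 X : tsum (fun _ : X => 0 : R) = 0.
Proof.
apply: tsum_eq => I [_ [I0 _ _]]; exists fset0 => G _.
by rewrite partial_sumE big1// subrr.
Qed.

Lemma tsumD X (r s : X -> R) : zero_convergent r -> zero_convergent s ->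
  tsum (fun x => r x + s x) = tsum r + tsum s.
Proof.
move=> zr zs; apply: tsum_eq => I oI.
have [F FI] := tsum_cvg zr oI; have [G GI] := tsum_cvg zs oI.
exists (F `|` G)%fset => H; rewrite fsubUset => /andP[/FI HF /GI HG].
rewrite partial_sumE big_split/= -!partial_sumE opprD addrACA.
by apply: right_idealD => //; case: oI.
Qed.

Lemma tsumMl X (a : R) (r : X -> R) : zero_convergent r ->
  tsum (fun x => a * r x) = a * tsum r.
Proof.
move=> zr; apply: tsum_eq => I oI.
have [F FI] := tsum_cvg zr (open_right_ideal_mulV a oI).
exists F => G /FI /=; rewrite mulrBr !partial_sumE.
by rewrite (big_distrr a).
Qed.

Lemma tsum1 X (x0 : X) (r : X -> R) : (forall x, x != x0 -> r x = 0) ->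
  tsum r = r x0.
Proof.
move=> r0; apply: tsum_eq => I [_ [I0 _ _]]; exists [fset x0]%fset => G.
rewrite fsub1set => x0G; rewrite partial_sumE (big_fsetD1 x0)//= big_seq.
rewrite big1 ?addr0 ?subrr// => x; rewrite !inE => /andP[xx0 _].
exact: r0.
Qed.

Lemma zero_convergent1 X (x0 : X) (r : X -> R) :
  (forall x, x != x0 -> r x = 0) -> zero_convergent r.
Proof.
move=> r0 I [_ [I0 _ _]]; apply: (@sub_finite_set _ _ [set x0]) => // x /=.
by apply: contra_notP => /eqP /r0 ->.
Qed.

End InfiniteSums.

(* R[[X]]: the formal sum of the r_x x is encoded by its family of coefficients *)
Record fsum (R : topologicalPzRingType) (X : choiceType) := Fsum {
  coef :> X -> R ;
  coef_zero_convergent : zero_convergent coef ;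
}.

Section FormalSums.
Variable R : rlTopRingType.
Implicit Types X Y : choiceType.

Lemma fsumP X (u v : fsum R X) : coef u =1 coef v -> u = v.
Proof.
case: u v => [u zu] [v zv] /= /funext uv; case: _ / uv zv => zv.
by rewrite (Prop_irrelevance zu zv).
Qed.

HB.instance Definition _ X := gen_eqMixin (fsum R X).
HB.instance Definition _ X := gen_choiceMixin (fsum R X).

Definition fsum0 X : fsum R X := Fsum (@zero_convergent0 R X).

Definition fsumD X (u v : fsum R X) : fsum R X :=
  Fsum (zero_convergentD (coef_zero_convergent u) (coef_zero_convergent v)).

Definition fsumZ X (a : R) (u : fsum R X) : fsum R X :=
  Fsum (zero_convergentMl a (coef_zero_convergent u)).

Lemma fsumDA X : associative (@fsumD X).
Proof. by move=> u v w; apply: fsumP => x /=; rewrite addrA. Qed.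

Lemma fsumDC X : commutative (@fsumD X).
Proof. by move=> u v; apply: fsumP => x /=; rewrite addrC. Qed.

Lemma fsum0D X : left_id (@fsum0 X) (@fsumD X).
Proof. by move=> u; apply: fsumP => x /=; rewrite add0r. Qed.

Lemma fsumND X : left_inverse (@fsum0 X) (fsumZ (-1)) (@fsumD X).
Proof. by move=> u; apply: fsumP => x /=; rewrite mulN1r addNr. Qed.

HB.instance Definition _ X := GRing.isZmodule.Build (fsum R X)
  (@fsumDA X) (@fsumDC X) (@fsum0D X) (@fsumND X).

Lemma fsumZA X (a b : R) (u : fsum R X) :
  fsumZ a (fsumZ b u) = fsumZ (a * b) u.
Proof. by apply: fsumP => x /=; rewrite mulrA. Qed.

Lemma fsum1Z X : left_id 1 (@fsumZ X).
Proof. by move=> u; apply: fsumP => x /=; rewrite mul1r. Qed.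

Lemma fsumZDr X : right_distributive (@fsumZ X) +%R.
Proof. by move=> a u v; apply: fsumP => x /=; rewrite mulrDr. Qed.

Lemma fsumZDl X (u : fsum R X) : {morph (@fsumZ X)^~ u : a b / a + b}.
Proof. by move=> a b; apply: fsumP => x /=; rewrite mulrDl. Qed.

HB.instance Definition _ X := GRing.Zmodule_isLmodule.Build R (fsum R X)
  (@fsumZA X) (@fsum1Z X) (@fsumZDr X) (@fsumZDl X).

Lemma fsum_unit_subproof X (x : X) :
  zero_convergent (fun y => if y == x then 1 else 0 : R).
Proof. by apply: (@zero_convergent1 R X x) => y /negPf ->. Qed.

Definition fsum_unit X (x : X) : fsum R X := Fsum (@fsum_unit_subproof X x).

Lemma zero_convergent_fiber X Y (f : X -> Y) (u : fsum R X) y :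
  zero_convergent (fun x => if f x == y then u x else 0).
Proof.
move=> I oI; apply: sub_finite_set (coef_zero_convergent u oI) => x /=.
by case: ifP => // _ /[swap] _; case: oI => _ [].
Qed.

Lemma fsum_map_subproof X Y (f : X -> Y) (u : fsum R X) :
  zero_convergent (fun y => tsum (fun x => if f x == y then u x else 0)).
Proof.
move=> I oI.
apply: sub_finite_set (finite_image f (coef_zero_convergent u oI)) => y /=.
apply: contra_notP => yI; apply: tsum_mem => //.
  exact: zero_convergent_fiber.
move=> x; case: ifP => [/eqP fxy|_]; last by case: oI => _ [].
by apply: contrapT => ux; apply: yI; exists x.
Qed.

(* R[[f]]: sum_x u_x x |-> sum_y (sum_(f x = y) u_x) y *)
Definition fsum_map X Y (f : X -> Y) (u : fsum R X) : fsum R Y :=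
  Fsum (@fsum_map_subproof X Y f u).

Lemma fsum_join_subproof X (w : fsum R (fsum R X)) :
  zero_convergent (fun x => tsum (fun t : fsum R X => w t * t x)).
Proof.
move=> I oI; set W := [set t | ~ I (w t)].
apply: (@sub_finite_set _ _ (\bigcup_(t in W) [set x | ~ I (w t * t x)])).
  move=> x /=; apply: contra_notP => xI; apply: tsum_mem => //.
    exact: zero_convergentMr (coef_zero_convergent w).
  move=> t; apply: contrapT => tI; apply: xI; exists t => // wI.
  by apply: tI; case: oI => _ [_ _]; apply.
apply: bigcup_finite => [|t _]; first exact: coef_zero_convergent.
exact: (zero_convergentMl (w t) (coef_zero_convergent t)).
Qed.

(* Multiplication of the monad: sum_t w_t t |-> sum_x (sum_t w_t t_x) x *)
Definition fsum_join X (w : fsum R (fsum R X)) : fsum R X :=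
  Fsum (@fsum_join_subproof X w).

Lemma fsum_map_is_linear X Y (f : X -> Y) : linear (fsum_map f).
Proof.
move=> a u v; apply: fsumP => y /=.
have zc := zero_convergent_fiber f ^~ y.
rewrite -tsumMl; last exact: zc.
rewrite -tsumD; [|exact: zero_convergentMl (zc u)|exact: zc].
by congr tsum; apply/funext => x; case: ifP; rewrite ?mulr0 ?addr0.
Qed.

Lemma fsum_join_is_linear X : linear (@fsum_join X).
Proof.
move=> a w w'; apply: fsumP => y /=.
have zc (v : fsum R (fsum R X)) := zero_convergentMr
  (fun t : fsum R X => t y) (coef_zero_convergent v).
rewrite -tsumMl; last exact: zc.
rewrite -tsumD; [|exact: zero_convergentMl (zc w)|exact: zc].
by congr tsum; apply/funext => t; rewrite mulrDl mulrA.
Qed.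

Lemma fsum_map_unit X Y (f : X -> Y) x : fsum_map f (fsum_unit x) = fsum_unit (f x).
Proof.
apply: fsumP => y /=; rewrite (@tsum1 _ _ x) ?eqxx 1?eq_sym// => x' /negPf ->.
by rewrite if_same.
Qed.

Lemma fsum_join_unit X (t : fsum R X) : fsum_join (fsum_unit t) = t.
Proof.
apply: fsumP => x /=; rewrite (@tsum1 _ _ t) ?eqxx ?mul1r// => t' /negPf ->.
by rewrite mul0r.
Qed.

End FormalSums.

HB.instance Definition _ (R : rlTopRingType) (X Y : choiceType) (f : X -> Y) :=
  GRing.isLinear.Build R (fsum R X) (fsum R Y) _ (fsum_map f) (fsum_map_is_linear f).
HB.instance Definition _ (R : rlTopRingType) (X : choiceType) :=
  GRing.isLinear.Build R (fsum R (fsum R X)) (fsum R X) _ (@fsum_join R X)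
    (@fsum_join_is_linear R X).

HB.mixin Record isContramodule (R : rlTopRingType) C & Choice C := {
  contraact : fsum R C -> C ;
  contraact_join : forall w : fsum R (fsum R C),
    contraact (fsum_map contraact w) = contraact (fsum_join w) ;
  contraact_unit : forall c : C, contraact (fsum_unit R c) = c ;
}.

#[short(type="contramodType")]
HB.structure Definition Contramodule (R : rlTopRingType) :=
  {C of Choice C & isContramodule R C}.

Definition contra_morphism (R : rlTopRingType) (C D : contramodType R)
    (f : C -> D) : Prop :=
  forall u : fsum R C, f (contraact u) = contraact (fsum_map f u).

(* The underlying left R-module: its operations are the images under the
   contraaction of the formal sums 1 c + 1 d, r c, 0 and (-1) c. *)
Definition contra_lmod (R : rlTopRingType) (C : contramodType R) : Type := C.

Section UnderlyingModule.
Variables (R : rlTopRingType) (C : contramodType R).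
Local Notation M := (contra_lmod C).
Local Notation act := (contraact : fsum R C -> M).
Local Notation unit := (@fsum_unit R C : M -> fsum R C).

HB.instance Definition _ := Choice.on M.

Definition cadd (c d : M) : M := act (unit c + unit d).
Definition cscale (r : R) (c : M) : M := act (r *: unit c).
Definition czero : M := act 0.
Definition copp (c : M) : M := act (- unit c).

Lemma act_unit c : act (unit c) = c. Proof. exact: contraact_unit. Qed.

Lemma act_map w : act (fsum_map act w) = act (fsum_join w).
Proof. exact: contraact_join. Qed.

Lemma actD u v : act (u + v) = cadd (act u) (act v).
Proof.
rewrite -[in LHS](fsum_join_unit u) -[in LHS](fsum_join_unit v) -linearD -act_map.
by rewrite linearD/= !fsum_map_unit.
Qed.

Lemma actZ r u : act (r *: u) = cscale r (act u).
Proof.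
rewrite -[in LHS](fsum_join_unit u) -linearZ -act_map.
by rewrite linearZ/= fsum_map_unit.
Qed.

Lemma actN u : act (- u) = copp (act u).
Proof.
rewrite -[in LHS](fsum_join_unit u) -linearN -act_map.
by rewrite linearN/= fsum_map_unit.
Qed.

Lemma caddA : associative cadd.
Proof.
move=> c d e; rewrite -[c]act_unit -[d]act_unit -[e]act_unit.
by rewrite -!actD addrA.
Qed.

Lemma caddC : commutative cadd.
Proof. by move=> c d; rewrite /cadd addrC. Qed.

Lemma cadd0 : left_id czero cadd.
Proof. by move=> c; rewrite -[c]act_unit -actD add0r. Qed.

Lemma caddN : left_inverse czero copp cadd.
Proof. by move=> c; rewrite -[c]act_unit -actN -actD addNr. Qed.

HB.instance Definition _ := GRing.isZmodule.Build M caddA caddC cadd0 caddN.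

Lemma cscaleA a b c : cscale a (cscale b c) = cscale (a * b) c.
Proof. by rewrite -[c]act_unit -!actZ scalerA. Qed.

Lemma cscale1 : left_id 1 cscale.
Proof. by move=> c; rewrite -[c]act_unit -actZ scale1r. Qed.

Lemma cscaleDr : right_distributive cscale +%R.
Proof.
move=> a c d; rewrite -[c]act_unit -[d]act_unit.
by rewrite -[_ + _]actD -!actZ -[RHS]actD scalerDr.
Qed.

Lemma cscaleDl c : {morph cscale^~ c : a b / a + b}.
Proof.
by move=> a b; rewrite -[c]act_unit -!actZ -[RHS]actD scalerDl.
Qed.

HB.instance Definition _ := GRing.Zmodule_isLmodule.Build R M
  cscaleA cscale1 cscaleDr cscaleDl.

End UnderlyingModule.

Section Contramodules.
Variable R : rlTopRingType.
Implicit Types C D E P : contramodType R.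

Definition subcontramodule C (D : set C) : Prop :=
  forall u : fsum R D, D (contraact (fsum_map (fun c : D => set_val c) u)).

(* The sum over x of the r_x c_x *)
Definition contrasum C (X : choiceType) (r : fsum R X) (c : X -> C) : C :=
  contraact (fsum_map c r).

Definition subcontra_sum C (X : choiceType) (D : X -> set C) : set C :=
  [set b | exists (r : fsum R X) (c : X -> C),
     (forall x, D x (c x)) /\ b = contrasum r c].

Definition lattice_finite C : Prop :=
  forall (X : choiceType) (D : X -> set C), (forall x, subcontramodule (D x)) ->
    subcontra_sum D = setT ->
    exists F : {fset X}, subcontra_sum (fun x : F => D (val x)) = setT.

(* Epimorphisms are the morphisms cancellable on the right in the category. *)
Definition contra_epi C D (f : C -> D) : Prop :=
  forall E (g h : D -> E), contra_morphism g -> contra_morphism h ->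
    g \o f =1 h \o f -> g =1 h.

Definition contra_projective P : Prop :=
  forall C D (q : C -> D) (f : P -> D),
    contra_morphism q -> contra_epi q -> contra_morphism f ->
    exists2 g : P -> C, contra_morphism g & q \o g =1 f.

Definition contra_ker C D (f : C -> D) : set C :=
  [set c | f c = 0 :> contra_lmod D].

(* The join of K and L is the sum of the two-member family (K, L). *)
Definition contra_superfluous C (K : set C) : Prop :=
  forall L : set C, subcontramodule L ->
    subcontra_sum (fun b : bool => if b then K else L) = setT -> L = setT.

Definition contra_projective_cover P C (p : P -> C) : Prop :=
  [/\ contra_morphism p, contra_epi p, contra_projective P
    & contra_superfluous (contra_ker p)].

End Contramodules.

Section Modules.
Variable R : pzRingType.
Implicit Types M N P Q : lmodType R.

Definition lmod_epi M N (f : {linear M -> N}) : Prop :=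
  forall Q (g h : {linear N -> Q}), g \o f =1 h \o f -> g =1 h.

Definition lmod_projective P : Prop :=
  forall M N (q : {linear M -> N}) (f : {linear P -> N}), lmod_epi q ->
    exists g : {linear P -> M}, q \o g =1 f.

Definition lmod_superfluous M (K : set M) : Prop :=
  forall L : set M, submod_closed (mem L) ->
    [set x + y | x in K & y in L] = setT -> L = setT.

Definition lmod_projective_cover P M (p : {linear P -> M}) : Prop :=
  [/\ lmod_epi p, lmod_projective P & lmod_superfluous [set x | p x = 0]].

End Modules.

Definition invertible (S : pzRingType) (x : S) : Prop :=
  exists y : S, x * y = 1 /\ y * x = 1.

Definition local_ring (S : pzRingType) : Prop :=
  (1 : S) <> 0 /\ zmod_closed [pred x : S | `[< ~ invertible x >]].

Definition corner_pred (S : pzRingType) (e : S) : {pred S} :=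
  [pred x | e * x * e == x].

(* The ring e S e, whose unit is e *)
Definition corner (S : pzRingType) (e : S) (ee : e * e = e) : Type :=
  {x : S | x \in corner_pred e}.

Section Corner.
Variables (S : pzRingType) (e : S) (ee : e * e = e).

Lemma corner_zmod_closed : zmod_closed (corner_pred e).
Proof.
split=> [|x y]; rewrite !inE ?mulr0 ?mul0r// => /eqP xe /eqP ye.
by rewrite mulrBr mulrBl xe ye.
Qed.

HB.instance Definition _ := GRing.isZmodClosed.Build S (corner_pred e)
  corner_zmod_closed.
HB.instance Definition _ := SubChoice.on (corner ee).
HB.instance Definition _ := [SubChoice_isSubZmodule of corner ee by <:].

Lemma corner_eM (x : corner ee) : e * val x = val x.
Proof. by have /eqP <- := valP x; rewrite !mulrA ee. Qed.

Lemma corner_Me (x : corner ee) : val x * e = val x.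
Proof. by have /eqP <- := valP x; rewrite -!mulrA ee. Qed.

Lemma corner1_subproof : e \in corner_pred e.
Proof. by rewrite inE !ee. Qed.

Lemma cornerM_subproof (x y : corner ee) : val x * val y \in corner_pred e.
Proof. by rewrite inE mulrA corner_eM -mulrA corner_Me. Qed.

Definition corner1 : corner ee := Sub e corner1_subproof.
Definition cornerM (x y : corner ee) : corner ee :=
  Sub (val x * val y) (cornerM_subproof x y).

Lemma cornerMA : associative cornerM.
Proof. by move=> x y z; apply: val_inj; rewrite !SubK mulrA. Qed.

Lemma corner1M : left_id corner1 cornerM.
Proof. by move=> x; apply: val_inj; rewrite !SubK corner_eM. Qed.

Lemma cornerM1 : right_id corner1 cornerM.
Proof. by move=> x; apply: val_inj; rewrite !SubK corner_Me. Qed.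

Lemma val_cornerM x y : val (cornerM x y) = val x * val y.
Proof. exact: SubK. Qed.

Lemma cornerMDl : left_distributive cornerM +%R.
Proof.
by move=> x y z; apply: val_inj; rewrite !(val_cornerM, raddfD) mulrDl.
Qed.

Lemma cornerMDr : right_distributive cornerM +%R.
Proof.
by move=> x y z; apply: val_inj; rewrite !(val_cornerM, raddfD) mulrDr.
Qed.

HB.instance Definition _ := GRing.Zmodule_isPzRing.Build (corner ee)
  cornerMA corner1M cornerM1 cornerMDl cornerMDr.

End Corner.

Definition topologically_semiperfect (R : topologicalPzRingType) : Prop :=
  exists (Z : choiceType) (e : Z -> R) (ee : forall z, e z * e z = e z),
    [/\ zero_convergent e, forall z w, z != w -> e z * e w = 0, tsum e = 1
      & forall z, local_ring (corner (ee z))].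

(* Main.v *)
From HB Require Import structures.
Require Import Defs.
From mathcomp Require Import all_boot all_order all_algebra finmap.
From mathcomp Require Import all_classical topology tvs.
From mathcomp.analysis.showcase Require Import summability.

(** Why the theorem holds.  Write [1] as the sum of the orthogonal local
    idempotents [e z].  Every [b] in [C] equals the sum over [z] of [e z *: b],
    so [C] is the join of the cyclic subcontramodules [R (e z *: c)], and
    lattice-finiteness leaves finitely many of them.  Keep a family
    [(c i, e i)], [i] in [I], that still generates [C] but from which no member
    can be dropped.

    The cover is [P], the direct sum of the left ideals [R (e i)], with
    [p : P -> C] sending [t] to the sum of the [t i *: c i].  Since [I] is finite,
    [P] is at once a contramodule and a module, and the same [p] serves both
    categories.  [P] is projective because its elements are the combinations of
    the basis vectors [e i] and a morphism out of [P] may be prescribed on these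
    ([projsum_contra_projective], [projsum_lmod_projective]).

    The kernel is superfluous because each [R (e i)] is a local module: as
    [e i R e i] is a local ring, the elements that do not generate [R (e i)] are
    closed under addition ([in_radD]).  A submodule of [P] all of whose elements
    have nongenerating coordinates is therefore superfluous, by Nakayama's
    argument carried out one coordinate at a time ([rad_superfluous]).  If some
    element of the kernel had a generating coordinate at [i], a multiple of it
    would express [e i *: c i] through the other generators, against the choice
    of the family ([irredundant_projective_cover]).  Superfluity among submodules
    implies superfluity among subcontramodules, because the join of two
    subcontramodules is their sum as submodules.

    Projectivity is tested against epimorphisms in the categorical sense, so it
    must be known that these are surjective: the projection onto the cokernel
    and zero agree after composition with the epimorphism, so they are equal
    ([lmod_epi_surj], [contra_epi_surj]).

    The calculations with infinite sums all reduce to one exchange of summations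
    ([tsum_exchange]), which says that the formal sums with composition
    [fsum_bind] form a monad and that [contrasum] is compatible with it
    ([contrasum_bind]). *)

Set Implicit Arguments.
Unset Strict Implicit.
Unset Printing Implicit Defensive.

Import GRing.Theory.

Local Open Scope classical_set_scope.
Local Open Scope ring_scope.

(** * Exchanging infinite sums *)

Section Fubini.
Variable R : rlTopRingType.
Implicit Types (X Y : choiceType) (I : set R).

Lemma eq_mod_open (x y : R) :
  (forall I, open_right_ideal I -> I (x - y)) -> x = y.
Proof.
by move=> h; apply/eqP; rewrite -subr_eq0; apply/eqP/right_linear_separated.
Qed.

(** Modulo an open right ideal an infinite sum is a finite one; by separatedness
    this reduces identities between infinite sums to finite sums. *)
Lemma tsum_mod_open X (r : X -> R) I (F : {fset X}) : zero_convergent r ->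
  open_right_ideal I -> (forall x, x \notin F -> I (r x)) ->
  I (tsum r - \sum_(x <- F) r x).
Proof.
move=> zr oI Ir; have rI : right_ideal I by case: oI.
have [G /(_ _ (fsubsetUr F G)) IG] := tsum_cvg zr oI.
rewrite -(subrK (partial_sum r (F `|` G)%fset) (tsum r)) -addrA.
by apply: right_idealD => //; rewrite -partial_sumE;
  apply: partial_sum_sub => //; exact: fsubsetUl.
Qed.

Lemma tsumMr X (r : X -> R) (a : R) : zero_convergent r ->
  tsum (fun x => r x * a) = tsum r * a.
Proof.
move=> zr; apply: tsum_eq => I oI; have [F FI] := tsum_cvg zr oI.
exists F => G /FI; rewrite !partial_sumE -mulr_suml -mulrBl.
by case: oI => _ [_ _]; exact.
Qed.

Lemma zero_convergent_row X Y (a : X * Y -> R) (x : X) :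
  zero_convergent a -> zero_convergent (fun y => a (x, y)).
Proof.
move=> za I oI; apply: sub_finite_set (finite_image snd (za I oI)) => y aI.
by exists (x, y).
Qed.

Lemma zero_convergent_swap X Y (a : X * Y -> R) :
  zero_convergent a -> zero_convergent (fun p : Y * X => a (p.2, p.1)).
Proof.
move=> za I oI.
apply: sub_finite_set (finite_image (fun p => (p.2, p.1)) (za I oI)).
by move=> [y x] aI; exists (x, y).
Qed.

Lemma zero_convergent_tsum X Y (a : X * Y -> R) : zero_convergent a ->
  zero_convergent (fun x => tsum (fun y => a (x, y))).
Proof.
move=> za I oI; apply: sub_finite_set (finite_image fst (za I oI)) => x /=.
apply: contra_notP => xI; apply: tsum_mem => //.
  exact: zero_convergent_row za.
by move=> y; apply: contrapT => aI; apply: xI; exists (x, y).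
Qed.

Lemma tsum2_mod_open X Y (a : X * Y -> R) I (F : {fset X}) (G : {fset Y}) :
  zero_convergent a -> open_right_ideal I ->
  (forall x y, ~ I (a (x, y)) -> x \in F /\ y \in G) ->
  I (tsum (fun x => tsum (fun y => a (x, y)))
     - \sum_(x <- F) \sum_(y <- G) a (x, y)).
Proof.
move=> za oI aI; have rI : right_ideal I by case: oI.
have aIl x : x \notin F -> I (tsum (fun y => a (x, y))).
  move=> xF; apply: tsum_mem => //; first exact: zero_convergent_row za.
  by move=> y; apply: contrapT => /aI[]; rewrite (negPf xF).
rewrite -(subrK (\sum_(x <- F) tsum (fun y => a (x, y))) (tsum _)) -addrA.
apply: right_idealD => //.
  exact: tsum_mod_open (zero_convergent_tsum za) oI aIl.
rewrite -sumrB; apply: right_ideal_sum => // x _.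
apply: tsum_mod_open => //; first exact: zero_convergent_row za.
by move=> y yG; apply: contrapT => /aI[_]; rewrite (negPf yG).
Qed.

(** Modulo each open right ideal only finitely many entries matter, so both
    iterated sums agree with the same finite double sum. *)
Lemma tsum_exchange X Y (a : X * Y -> R) : zero_convergent a ->
  tsum (fun x => tsum (fun y => a (x, y))) =
  tsum (fun y => tsum (fun x => a (x, y))).
Proof.
move=> za; apply: eq_mod_open => I oI; have rI : right_ideal I by case: oI.
pose F := fset_set (fst @` [set p | ~ I (a p)]).
pose G := fset_set (snd @` [set p | ~ I (a p)]).
have aI x y : ~ I (a (x, y)) -> x \in F /\ y \in G.
  move=> nI; rewrite !in_fset_set; try exact/finite_image/za.
  by rewrite !in_setE; split; exists (x, y).
have h1 := tsum2_mod_open za oI aI.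
have := @tsum2_mod_open _ _ (fun p => a (p.2, p.1)) I G F
  (zero_convergent_swap za) oI.
move=> /(_ (fun y x h => let: conj p q := aI x y h in conj q p)) /= h2.
rewrite exchange_big /= in h2.
by case: rI => _ IB _; have := IB _ _ h1 h2; rewrite opprB addrA subrK.
Qed.

Lemma zero_convergent_bind X Y (u : fsum R X) (v : X -> fsum R Y) :
  zero_convergent (fun p : X * Y => u p.1 * v p.1 p.2).
Proof.
move=> I oI; set W := [set x | ~ I (u x)].
apply: (@sub_finite_set _ _
  (\bigcup_(x in W) [set (x, y) | y in [set y | ~ I (u x * v x y)]])).
  move=> [x y] /= xyI; exists x; last by exists y.
  by apply: contra_not xyI; case: oI => _ [_ _]; apply.
apply: bigcup_finite => [|x _]; first exact: coef_zero_convergent.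
apply: finite_image.
exact: (zero_convergentMl (u x) (coef_zero_convergent (v x))).
Qed.

(** Composition in the Kleisli category of the monad of formal sums: substitute
    the formal sum [v x] for each [x].  The map and the multiplication of the
    monad are its special cases [fsum_mapE] and [fsum_joinE]. *)
Definition fsum_bind X Y (u : fsum R X) (v : X -> fsum R Y) : fsum R Y :=
  Fsum (zero_convergent_tsum (zero_convergent_swap (zero_convergent_bind u v))).

(** Exchange of summations in the form in which it is used: for [g] a
    coefficient function it is the associativity of substitution, and for [g] a
    coordinate of a contramodule it is the associativity of the contraaction. *)
Lemma tsum_bind X Y (u : fsum R X) (v : X -> fsum R Y) (g : Y -> R) :
  tsum (fun y => fsum_bind u v y * g y) =
  tsum (fun x => u x * tsum (fun y => v x y * g y)).
Proof.
have zv := zero_convergent_bind u v.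
transitivity (tsum (fun y => tsum (fun x => u x * v x y * g y))).
  congr tsum; apply/funext => y; rewrite tsumMr//.
  exact: (zero_convergent_row y (zero_convergent_swap zv)).
rewrite -(@tsum_exchange _ _ (fun p : X * Y => u p.1 * v p.1 p.2 * g p.2)).
  congr tsum; apply/funext => x; rewrite -tsumMl/=.
    by congr tsum; apply/funext => y; rewrite mulrA.
  exact/zero_convergentMr/coef_zero_convergent.
exact: (zero_convergentMr (fun p : X * Y => g p.2) zv).
Qed.

Lemma tsum_unit X (x : X) (g : X -> R) :
  tsum (fun y => fsum_unit R x y * g y) = g x.
Proof.
by rewrite (@tsum1 _ _ x) /= ?eqxx ?mul1r// => y /negPf ->; rewrite mul0r.
Qed.

Lemma fsum_bindA X Y (T : choiceType) (u : fsum R X) (v : X -> fsum R Y)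
    (w : Y -> fsum R T) :
  fsum_bind (fsum_bind u v) w = fsum_bind u (fun x => fsum_bind (v x) w).
Proof. by apply: fsumP => t; rewrite /= tsum_bind. Qed.

Lemma fsum_mapE X Y (f : X -> Y) (u : fsum R X) :
  fsum_map f u = fsum_bind u (fun x => fsum_unit R (f x)).
Proof.
apply: fsumP => y /=; congr tsum; apply/funext => x.
by rewrite [y == _]eq_sym; case: ifP; rewrite (mulr1, mulr0).
Qed.

Lemma fsum_joinE X (w : fsum R (fsum R X)) : fsum_join w = fsum_bind w id.
Proof. exact: fsumP. Qed.

Lemma tsum_map X Y (f : X -> Y) (u : fsum R X) (g : Y -> R) :
  tsum (fun y => fsum_map f u y * g y) = tsum (fun x => u x * g (f x)).
Proof.
by rewrite fsum_mapE tsum_bind; congr tsum; apply/funext => x; rewrite tsum_unit.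
Qed.

Lemma fsum_bind_map X Y (T : choiceType) (f : X -> Y) (u : fsum R X)
    (v : Y -> fsum R T) :
  fsum_bind (fsum_map f u) v = fsum_bind u (v \o f).
Proof. by apply: fsumP => t; rewrite /= tsum_map. Qed.

Lemma fsum_map_comp X Y (T : choiceType) (f : X -> Y) (g : Y -> T) (u : fsum R X) :
  fsum_map g (fsum_map f u) = fsum_map (g \o f) u.
Proof. by rewrite [LHS]fsum_mapE fsum_bind_map -fsum_mapE. Qed.

Lemma fsum_map_bind X Y (T : choiceType) (u : fsum R X) (v : X -> fsum R Y)
    (f : Y -> T) :
  fsum_map f (fsum_bind u v) = fsum_bind u (fun x => fsum_map f (v x)).
Proof.
rewrite fsum_mapE fsum_bindA; congr fsum_bind; apply/funext => x.
by rewrite fsum_mapE.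
Qed.

Lemma fsum_bindD X Y (u : fsum R X) (v v' : X -> fsum R Y) :
  fsum_bind u (fun x => v x + v' x) = fsum_bind u v + fsum_bind u v'.
Proof.
apply: fsumP => y /=; rewrite -tsumD.
- by congr tsum; apply/funext => x; rewrite /= mulrDr.
- exact: (zero_convergent_row y (zero_convergent_swap (zero_convergent_bind u v))).
- exact: (zero_convergent_row y (zero_convergent_swap (zero_convergent_bind u v'))).
Qed.

Lemma zero_convergent_fin (I : finType) (r : I -> R) : zero_convergent r.
Proof. by move=> J _; exact: finite_finset. Qed.

Definition fin_fsum (I : finType) (r : I -> R) : fsum R I :=
  Fsum (@zero_convergent_fin I r).

Lemma fsum_finE (I : finType) (u : fsum R I) :
  u = \sum_i u i *: fsum_unit R i.
Proof.
apply: fsumP => i.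
have -> (s : seq I) (f : I -> fsum R I) :
    (\sum_(j <- s) f j : fsum R I) i = \sum_(j <- s) (f j i).
  by elim: s => [|j s IH]; rewrite ?big_nil ?big_cons//= IH.
rewrite (bigD1 i)//= eqxx mulr1 big1 ?addr0// => j /negPf.
by rewrite eq_sym => ->; rewrite mulr0.
Qed.

End Fubini.

(** * Infinite combinations in a contramodule *)

Section Contrasum.
Variables (R : rlTopRingType) (C : contramodType R).
Implicit Types X Y : choiceType.

Lemma contrasum_bind X Y (u : fsum R X) (v : X -> fsum R Y) (c : Y -> C) :
  contrasum (fsum_bind u v) c = contrasum u (fun x => contrasum (v x) c).
Proof.
rewrite /contrasum fsum_map_bind.
rewrite -(fsum_map_comp (fun x => fsum_map c (v x)) contraact).
by rewrite contraact_join fsum_joinE fsum_bind_map.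
Qed.

Lemma contrasum_unit X (x : X) (c : X -> C) : contrasum (fsum_unit R x) c = c x.
Proof. by rewrite /contrasum fsum_map_unit contraact_unit. Qed.

Lemma contrasum_map X Y (f : X -> Y) (u : fsum R X) (c : Y -> C) :
  contrasum (fsum_map f u) c = contrasum u (c \o f).
Proof. by rewrite /contrasum fsum_map_comp. Qed.

Lemma contraactE (u : fsum R C) : contraact u = contrasum u id.
Proof.
rewrite /contrasum; congr contraact; apply: fsumP => c /=.
by rewrite (@tsum1 _ _ c) ?eqxx// => x /negPf ->.
Qed.

Lemma contrasum_linear X (c : X -> C) :
  linear (fun u : fsum R X => contrasum u c : contra_lmod C).
Proof. by move=> a u v; rewrite /contrasum linearD linearZ/= actD actZ. Qed.

Lemma contrasumDl X (c : X -> C) (u v : fsum R X) :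
  contrasum (u + v) c =
  (contrasum u c : contra_lmod C) + (contrasum v c : contra_lmod C)
  :> contra_lmod C.
Proof. by rewrite /contrasum linearD actD. Qed.

(** Substitute the two-term formal sum of the points [inl x] and [inr x] of a
    disjoint union for each [x]. *)
Lemma contrasumD X (u : fsum R X) (c d : X -> contra_lmod C) :
  contrasum u (fun x => c x + d x : contra_lmod C) =
  (contrasum u c : contra_lmod C) + (contrasum u d : contra_lmod C)
  :> contra_lmod C.
Proof.
pose v x : fsum R (X + X)%type := fsum_unit R (inl x) + fsum_unit R (inr x).
pose cd (z : X + X) : C := match z with inl x => c x | inr x => d x end.
transitivity (contrasum u (fun x => contrasum (v x) cd)).
  by congr contrasum; apply/funext => x; rewrite contrasumDl !contrasum_unit.
rewrite -contrasum_bind fsum_bindD contrasumDl !contrasum_bind.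
by apply: (f_equal2 +%R); congr contrasum; apply/funext => x;
  rewrite contrasum_unit.
Qed.

Lemma contrasum_fin (I : finType) (u : fsum R I) (c : I -> contra_lmod C) :
  contrasum u c = \sum_i u i *: c i :> contra_lmod C.
Proof.
rewrite {1}[u]fsum_finE.
have h := contrasum_linear (c : I -> C).
pose hL := GRing.isLinear.Build R (fsum R I) (contra_lmod C) *:%R _ h.
pose H : {linear fsum R I -> contra_lmod C} :=
  HB.pack (fun u : fsum R I => contrasum u c : contra_lmod C) hL.
rewrite -[LHS]/(H _) linear_sum; apply: eq_bigr => i _.
by rewrite linearZ/= contrasum_unit.
Qed.

End Contrasum.

Section ContraMorphism.
Variables (R : rlTopRingType) (C D : contramodType R) (f : C -> D).
Hypothesis hf : contra_morphism f.

Lemma contra_morphism_sum (X : choiceType) (u : fsum R X) (c : X -> C) :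
  f (contrasum u c) = contrasum u (f \o c).
Proof. by rewrite /contrasum hf fsum_map_comp. Qed.

Lemma contra_morphism_linear :
  linear (f : contra_lmod C -> contra_lmod D).
Proof.
move=> a x y.
have -> : a *: x + y = contraact (a *: fsum_unit R (x : C) + fsum_unit R (y : C)).
  by rewrite actD actZ !act_unit.
by rewrite hf linearD linearZ/= !fsum_map_unit actD actZ !act_unit.
Qed.

End ContraMorphism.


(** * Quotients, and surjectivity of epimorphisms *)

Section Quotients.

(** The additive group underlying the quotient module and the quotient
    contramodule.  The section [s] serves to transport operations from [M] to
    [Q], which then have to be shown independent of representatives. *)
Lemma zmod_quotient (M : zmodType) (E : {pred M}) : zmod_closed E ->
  exists (Q : zmodType) (pi : {additive M -> Q}) (s : Q -> M),
    cancel s pi /\ forall x, pi x = 0 <-> x \in E.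
Proof.
move=> hE; pose cE := GRing.isZmodClosed.Build M E hE.
pose I : zmodClosed M := HB.pack E cE.
exists (Quotient.quot I : zmodType), \pi_(Quotient.quot I)%qT, repr.
split=> [x|x]; first exact: reprK.
rewrite -[x in x \in E]subr0 -[_ \in E]/(_ \in I) Quotient.idealrBE -pi_zeror.
by split=> /eqP.
Qed.

Variable R : pzRingType.

Lemma lmod_quotient (M : lmodType R) (E : {pred M}) : submod_closed E ->
  exists (Q : lmodType R) (pi : {linear M -> Q}), forall x, pi x = 0 <-> x \in E.
Proof.
move=> hE.
have [[Q cQ] [pi [s [sK piE]]]] := zmod_quotient (GRing.submod_closedB hE).
pose Z := GRing.Zmodule.Pack cQ; pose sc (a : R) (q : Z) : Z := pi (a *: s q).
have scE a y : sc a (pi y) = pi (a *: y).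
  apply/eqP; rewrite -subr_eq0 -raddfB -scalerBr; apply/eqP/piE.
  have /piE Ey : pi (s (pi y) - y) = 0 by rewrite raddfB sK subrr.
  by rewrite -[_ *: _]addr0; apply: hE.2; [exact: Ey|exact: hE.1].
have scA a b q : sc a (sc b q) = sc (a * b) q by rewrite -[q]sK !scE scalerA.
have sc1 : left_id 1 sc by move=> q; rewrite -[q]sK scE scale1r.
have scDr : right_distributive (sc : R -> Z -> Z) +%R.
  by move=> a p q; rewrite -[p]sK -[q]sK -raddfD !scE scalerDr raddfD.
have scDl q : {morph (fun a => sc a q : Z) : a b / a + b}.
  by move=> a b; rewrite -[q]sK !scE scalerDl raddfD.
pose mQ := GRing.Zmodule_isLmodule.Build R Z scA sc1 scDr scDl.
pose L : lmodType R := HB.pack Q cQ mQ.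
have lpi : linear (pi : M -> L) by move=> a x y; rewrite raddfD -[pi (a *: x)]scE.
pose piL : {linear M -> L} :=
  HB.pack (pi : M -> L) (GRing.isLinear.Build R M L _ _ lpi).
by exists L, piL.
Qed.

Lemma lmod_epi_surj (M N : lmodType R) (f : {linear M -> N}) :
  lmod_epi f -> forall y, exists x, f x = y.
Proof.
move=> epi_f; pose E : {pred N} := [pred y | `[< exists x, f x = y >]].
have EP y : reflect (exists x, f x = y) (y \in E) by exact: asboolP.
have [|Q [pi piE]] := @lmod_quotient N E.
  split=> [|a _ _ /EP[x <-] /EP[y <-]]; apply/EP.
    by exists 0; rewrite linear0.
  by exists (a *: x + y); rewrite linearP.
move=> y; apply/EP/piE; apply: (epi_f Q pi \0) => x.
by apply/piE/EP; exists x.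
Qed.

End Quotients.

Section Subcontramodules.
Variables (R : rlTopRingType) (C : contramodType R).

Lemma contrasum_mem (E : set C) (X : choiceType) (u : fsum R X) (c : X -> C) :
  subcontramodule E -> (forall x, E (c x)) -> E (contrasum u c).
Proof.
move=> hE Ec; have := hE (fsum_map (fun x => SigSub (mem_set (Ec x)) : E) u).
by rewrite fsum_map_comp.
Qed.

(** The module operations are finite contraactions. *)
Lemma submod_closed_subcontra (E : set C) : subcontramodule E ->
  submod_closed (mem E : {pred contra_lmod C}).
Proof.
move=> hE; split=> [|a x y xE yE]; apply: mem_set.
  pose u := @fin_fsum R void (fun=> 0).
  have := @contrasum_mem E void u (fun v => match v with end) hE.
  by rewrite (@contrasum_fin R C void) big1 => [|[]//]; apply; case.
pose u := @fin_fsum R bool (fun b => if b then a else 1).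
have := @contrasum_mem E bool u (fun b => if b then x else y) hE.
rewrite (@contrasum_fin R C bool) big_bool/= scale1r; apply.
by case; exact: set_mem.
Qed.

Lemma contrasum0 (X : choiceType) (u : fsum R X) :
  contrasum u (fun=> 0 : contra_lmod C) = 0 :> contra_lmod C.
Proof.
have := contrasumD u (fun=> 0 : contra_lmod C) (fun=> 0).
rewrite addr0 => h.
apply: (@addrI _ (contrasum u (fun=> 0 : contra_lmod C) : contra_lmod C)).
by rewrite addr0 -h.
Qed.

(** The contraaction on the quotient applies that of [C] to representatives.  It
    is well defined because replacing each [x] in a formal sum by a
    representative [c x] of its class changes the result by the combination
    of the differences [x - c x], all of which lie in [E]. *)
Lemma contra_quotient (E : set C) : subcontramodule E ->
  exists (Q : contramodType R) (pi : C -> Q), contra_morphism pi /\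
    forall x y : contra_lmod C, pi x = pi y <-> E (x - y).
Proof.
move=> hE.
have [[Q cQ] [pi [s [sK piE]]]] :=
  zmod_quotient (GRing.submod_closedB (submod_closed_subcontra hE)).
pose Z := GRing.Zmodule.Pack cQ.
have pi_eq (x y : contra_lmod C) : pi x = pi y <-> E (x - y).
  split=> [xy|Exy].
    by apply/set_mem/piE; rewrite raddfB xy subrr.
  by apply/eqP; rewrite -subr_eq0 -raddfB; apply/eqP/piE/mem_set.
pose act (u : fsum R Z) : Z := pi (contraact (fsum_map (s : Z -> C) u)).
have actE (u : fsum R C) : pi (contraact u) = act (fsum_map (pi : C -> Z) u).
  rewrite /act fsum_map_comp contraactE -/(contrasum _ _) pi_eq.
  pose c (x : C) : contra_lmod C := s (pi x).
  have -> : contrasum u id = contrasum u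
      (fun x => c x + ((x : contra_lmod C) - c x) : contra_lmod C).
    by congr contrasum; apply/funext => x; rewrite addrC subrK.
  rewrite contrasumD addrC addKr; apply: contrasum_mem => // x.
  by apply/pi_eq; rewrite sK.
have act_unitZ (z : Z) : act (fsum_unit R z) = z.
  by rewrite /act fsum_map_unit contraact_unit sK.
have act_joinZ (w : fsum R (fsum R Z)) :
    act (fsum_map act w) = act (fsum_join w).
  have -> : fsum_map act w = fsum_map (pi : C -> Z)
      (fsum_map contraact (fsum_map (fsum_map (s : Z -> C)) w)).
    by rewrite !fsum_map_comp.
  rewrite -actE contraact_join /act; congr (pi (contraact _)).
  by rewrite !fsum_joinE fsum_bind_map fsum_map_bind.
pose mQ := isContramodule.Build R Z act_joinZ act_unitZ.
pose D : contramodType R := HB.pack Q cQ mQ.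
by exists D, pi; split.
Qed.

End Subcontramodules.

Section Epimorphisms.
Variables (R : rlTopRingType) (C D : contramodType R).

Lemma contra_epi_surj (f : C -> D) : contra_morphism f -> contra_epi f ->
  forall y, exists x, f x = y.
Proof.
move=> hf epi_f; pose E : set D := [set y | exists x, f x = y].
have hE : subcontramodule E.
  move=> u; have [g gE] : {g : E -> C & forall y, f (g y) = set_val y}.
    apply: (@choice E C (fun y x => f x = set_val y)) => -[y Ey].
    exact: (set_mem Ey).
  exists (contraact (fsum_map g u)); rewrite hf fsum_map_comp.
  by congr (contraact (fsum_map _ _)); apply/funext => y; rewrite -gE.
have [Q [pi [hpi piE]]] := contra_quotient hE.
have f0 : E (0 : contra_lmod D) by have /set_mem := (submod_closed_subcontra hE).1.
have h0 : contra_morphism (fun _ : D => pi (0 : contra_lmod D)).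
  move=> u; rewrite -[RHS]/(contrasum u _).
  rewrite -(contra_morphism_sum hpi u (fun=> 0 : contra_lmod D)).
  by rewrite contrasum0.
move=> y; have : pi y = pi (0 : contra_lmod D).
  apply: (epi_f Q pi _ hpi h0) => x /=; apply/piE; rewrite subr0.
  by exists x.
by move=> /piE; rewrite subr0.
Qed.

Lemma surj_contra_epi (f : C -> D) : (forall y, exists x, f x = y) -> contra_epi f.
Proof. by move=> sf E g h _ _ gh y; have [x <-] := sf y; exact: gh. Qed.

End Epimorphisms.

(** * The radical of the left ideal of a local idempotent *)

Section LocalIdempotent.
Variables (S : pzRingType) (e : S) (ee : e * e = e).
Hypothesis loc : local_ring (corner ee).

(** For [x] in [S e], where [e S e] is local, this is membership in the unique
    maximal submodule of [S e]: the submodule generated by [x] misses [e]. *)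
Definition in_rad (x : S) : Prop := ~ exists r, r * x = e.

Lemma in_radM a x : in_rad x -> in_rad (a * x).
Proof. by move=> rx [r rax]; apply: rx; exists (r * a); rewrite -mulrA. Qed.

Lemma in_rad0 : in_rad 0.
Proof.
move=> [r]; rewrite mulr0 => e0; have [+ _] := loc; apply.
by apply: val_inj; rewrite /= -e0.
Qed.

(** If [r (x + y) = e], then [e r x] and [e r y] are elements of [e S e] with
    sum [e], so one of them is invertible there, and that one generates [S e]. *)
Lemma in_radD x y : x * e = x -> y * e = y ->
  in_rad x -> in_rad y -> in_rad (x + y).
Proof.
move=> xe ye rx ry [r rxy].
have cor z : z * e = z -> e * (r * z) \in corner_pred e.
  by move=> ze; rewrite inE !mulrA ee -!mulrA ze.
pose c z ze : corner ee := Sub (e * (r * z)) (cor z ze).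
have nc z ze : in_rad z -> c z ze \in [pred x : corner ee | `[< ~ invertible x >]].
  move=> rz; apply/asboolP => -[w [_ /(congr1 val)]].
  rewrite val_cornerM SubK => wz.
  by apply: rz; exists (val w * (e * r)); rewrite -!mulrA.
have [_ [N0 NB]] := loc.
have /asboolP := NB _ _ (nc x xe rx) (NB _ _ N0 (nc y ye ry)); apply.
rewrite sub0r opprK; suff -> : c x xe + c y ye = 1 by exists 1; rewrite mulr1.
by apply: val_inj; rewrite /= -mulrDr -mulrDr rxy ee.
Qed.

Lemma in_rad_compl x y : x * e = x -> y * e = y -> x + y = e -> in_rad x ->
  exists r, r * y = e.
Proof.
move=> xe ye xy rx; apply: contrapT => ry.
by apply: (in_radD xe ye rx ry); exists 1; rewrite xy mul1r.
Qed.

End LocalIdempotent.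

(** * The direct sum of finitely many left ideals generated by idempotents *)

(** An element of the left ideal generated by an idempotent [e i] is recognized
    by [t i * e i = t i]. *)
Definition projsum (R : pzRingType) (I : finType) (e : I -> R) : Type :=
  {t : {ffun I -> R} | [forall i, t i * e i == t i]}.

HB.instance Definition _ (R : pzRingType) (I : finType) (e : I -> R) :=
  Choice.on (projsum e).

Section ProjsumContramodule.
Variables (R : rlTopRingType) (I : finType) (e : I -> R).
Local Notation P := (projsum e).

Definition pcoord (t : P) : I -> R := sval t.

Lemma pcoordM (t : P) i : pcoord t i * e i = pcoord t i.
Proof. exact/eqP/(forallP (valP t) i). Qed.

Lemma pcoord_inj (s t : P) : pcoord s =1 pcoord t -> s = t.
Proof. by move=> st; apply/val_inj/ffunP. Qed.

Lemma projsum_of_subproof (r : I -> R) : (forall i, r i * e i = r i) ->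
  [forall i, finfun r i * e i == finfun r i].
Proof. by move=> re; apply/forallP => i; rewrite ffunE re. Qed.

Definition projsum_of (r : I -> R) (re : forall i, r i * e i = r i) : P :=
  exist _ (finfun r) (projsum_of_subproof re).

Lemma projsum_ofE r re : pcoord (@projsum_of r re) =1 r.
Proof. by move=> i; rewrite /pcoord ffunE. Qed.

Lemma zero_convergent_pcoord (u : fsum R P) i :
  zero_convergent (fun t : P => u t * pcoord t i).
Proof. exact/zero_convergentMr/coef_zero_convergent. Qed.

Lemma projsum_act_subproof (u : fsum R P) i :
  tsum (fun t : P => u t * pcoord t i) * e i = tsum (fun t => u t * pcoord t i).
Proof.
rewrite -tsumMr; last exact: zero_convergent_pcoord.
by congr tsum; apply/funext => t; rewrite -mulrA pcoordM.
Qed.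

Definition projsum_act (u : fsum R P) : P := projsum_of (projsum_act_subproof u).

Lemma pcoord_act u i : pcoord (projsum_act u) i = tsum (fun t => u t * pcoord t i).
Proof. exact: projsum_ofE. Qed.

Lemma projsum_act_join (w : fsum R (fsum R P)) :
  projsum_act (fsum_map projsum_act w) = projsum_act (fsum_join w).
Proof.
apply: pcoord_inj => i; rewrite !pcoord_act tsum_map fsum_joinE tsum_bind.
by congr tsum; apply/funext => u; rewrite pcoord_act.
Qed.

Lemma projsum_act_unit (t : P) : projsum_act (fsum_unit R t) = t.
Proof. by apply: pcoord_inj => i; rewrite pcoord_act tsum_unit. Qed.

HB.instance Definition _ :=
  isContramodule.Build R P projsum_act_join projsum_act_unit.

Lemma pcoordD (s t : contra_lmod P) i :
  pcoord (s + t) i = pcoord s i + pcoord t i.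
Proof.
rewrite -[LHS]/(pcoord (projsum_act _) i) pcoord_act.
rewrite -[in RHS](projsum_act_unit s) -[in RHS](projsum_act_unit t) !pcoord_act.
rewrite -tsumD; try exact: zero_convergent_pcoord.
by congr tsum; apply/funext => x; rewrite /= mulrDl.
Qed.

Lemma pcoordZ a (t : contra_lmod P) i : pcoord (a *: t) i = a * pcoord t i.
Proof.
rewrite -[LHS]/(pcoord (projsum_act _) i) pcoord_act.
rewrite -[in RHS](projsum_act_unit t) pcoord_act.
rewrite -tsumMl; last exact: zero_convergent_pcoord.
by congr tsum; apply/funext => x; rewrite /= mulrA.
Qed.

Lemma pcoordB (s t : contra_lmod P) i :
  pcoord (s - t) i = pcoord s i - pcoord t i.
Proof. by rewrite -scaleN1r pcoordD pcoordZ mulN1r. Qed.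

Lemma projsum_act_coord (u : fsum R P) :
  fin_fsum (pcoord (contraact u)) = fsum_bind u (fun t => fin_fsum (pcoord t)).
Proof. by apply: fsumP => i; rewrite /= pcoord_act. Qed.

Definition lincomb (C : contramodType R) (c : I -> C) (t : P) : C :=
  contrasum (fin_fsum (pcoord t)) c.

Lemma lincomb_morphism (C : contramodType R) (c : I -> C) :
  contra_morphism (lincomb c).
Proof. by move=> u; rewrite /lincomb projsum_act_coord contrasum_bind. Qed.

Lemma lincombE (C : contramodType R) (c : I -> contra_lmod C) (t : P) :
  lincomb c t = \sum_i pcoord t i *: c i :> contra_lmod C.
Proof. exact: contrasum_fin. Qed.

Hypothesis ee : forall i, e i * e i = e i.

Lemma pbasis_subproof i j :
  (if j == i then e i else 0) * e j = if j == i then e i else 0.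
Proof. by case: eqP => [->|]; rewrite ?ee ?mul0r. Qed.

Definition pbasis i : P := projsum_of (pbasis_subproof i).

Lemma pbasisE i j : pcoord (pbasis i) j = if j == i then e i else 0.
Proof. exact: projsum_ofE. Qed.

Lemma lincomb_basis (t : P) : lincomb pbasis t = t.
Proof.
apply: pcoord_inj => j; rewrite pcoord_act tsum_map /= (@tsum1 _ _ j) => [|i].
  by rewrite pbasisE eqxx pcoordM.
by rewrite pbasisE eq_sym => /negPf ->; rewrite mulr0.
Qed.

Lemma projsum_contra_projective : contra_projective P.
Proof.
move=> C D q f hq eq hf; have sq := contra_epi_surj hq eq.
have [c cE] : {c : I -> C & forall i, q (c i) = f (pbasis i)}.
  by apply: (@choice _ _ (fun i x => q x = f (pbasis i))) => i; exact: sq.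
exists (lincomb c); first exact: lincomb_morphism.
move=> t /=; rewrite -[t in RHS]lincomb_basis !(contra_morphism_sum _) //.
by congr contrasum; apply/funext => i; rewrite /= cE.
Qed.

Lemma projsum_lmod_projective : lmod_projective (contra_lmod P).
Proof.
move=> M N q f eq; have sq := lmod_epi_surj eq.
have [m mE] : {m : I -> M & forall i, q (m i) = f (pbasis i)}.
  by apply: (@choice _ _ (fun i x => q x = f (pbasis i))) => i; exact: sq.
pose g (t : contra_lmod P) : M := \sum_i pcoord t i *: m i.
have lg : linear g.
  move=> a s t; rewrite /g scaler_sumr -big_split; apply: eq_bigr => i _ /=.
  by rewrite pcoordD pcoordZ scalerDl scalerA.
pose G : {linear contra_lmod P -> M} :=
  HB.pack g (GRing.isLinear.Build R _ M _ _ lg).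
exists G => t /=; rewrite -[t in RHS]lincomb_basis.
rewrite (lincombE (pbasis : I -> contra_lmod P)).
rewrite /g !linear_sum; apply: eq_bigr => i _.
by rewrite !linearZ /= mE.
Qed.

Hypothesis loc : forall i, local_ring (corner (ee i)).

(** Nakayama's argument.  [L], together with the elements with radical
    coordinates that are supported on [s], is assumed to span everything, and
    [s] is shrunk to the empty list.  At [i], the basis vector differs from some
    [l] in [L] by such an element [d]; the coordinate [e i - d i] of [l] at [i]
    is a generator, so a multiple of [l] has coordinate [e i] at [i] and can be
    used to clear the coordinate [i] of any other difference. *)
Lemma rad_superfluous_seq (L : set (contra_lmod P)) (s : seq I) :
  submod_closed (mem L) ->
  (forall t, exists2 l, L l & forall i,
     in_rad (e i) (pcoord (t - l) i) /\ (i \notin s -> pcoord (t - l) i = 0)) ->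
  L = setT.
Proof.
move=> [/set_mem L0 Llin].
have LP a x y : L x -> L y -> L (a *: x + y).
  by move=> Lx Ly; apply/set_mem/Llin; exact: mem_set.
elim: s => [|i s IH] LJ.
  apply/seteqP; split=> // t _; have [l Ll lE] := LJ t.
  suff -> : t = l by [].
  apply: pcoord_inj => i; apply/eqP; rewrite -subr_eq0 -pcoordB.
  by apply/eqP; apply: (lE i).2.
have [l Ll [lii lij]] : exists2 l, L l & pcoord l i = e i /\ forall j, j != i ->
    in_rad (e j) (pcoord l j) /\ (j \notin s -> pcoord l j = 0).
  have [l Ll lE] := LJ (pbasis i).
  have dE j := pcoordB (pbasis i) l j.
  have [r rl] : exists r, r * pcoord l i = e i.
    apply: (in_rad_compl (loc i) (x := pcoord ((pbasis i : contra_lmod P) - l) i)).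
    - exact: pcoordM.
    - exact: pcoordM.
    - by rewrite dE subrK pbasisE eqxx.
    - exact: (lE i).1.
  exists (r *: l); first by rewrite -[r *: l]addr0; exact: LP.
  split=> [|j ji]; first by rewrite pcoordZ.
  have lj : pcoord l j = -1 * pcoord ((pbasis i : contra_lmod P) - l) j.
    by rewrite dE pbasisE (negPf ji) sub0r mulN1r opprK.
  rewrite pcoordZ lj; have [rj j0] := lE j; split=> [|js].
    by do 2!apply: in_radM.
  by rewrite j0 ?mulr0// inE negb_or ji.
apply: IH => t; have [l' Ll' l'E] := LJ t.
pose a := pcoord (t - l') i.
exists (a *: l + l') => [|j]; first exact: LP.
have -> : pcoord (t - (a *: l + l')) j = pcoord (t - l') j - a * pcoord l j.
  by rewrite opprD addrA addrAC pcoordB pcoordZ.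
have [->|ji] := eqVneq j i.
  by rewrite lii pcoordM subrr; split=> //; exact: (in_rad0 (loc i)).
have [r1 z1] := l'E j; have [r2 z2] := lij j ji; split.
  rewrite -mulN1r; apply: (in_radD (loc j)); rewrite -?mulrA ?pcoordM//.
  by do 2!apply: in_radM.
by move=> js; rewrite z1 ?z2 ?mulr0 ?subr0// inE negb_or ji.
Qed.

Lemma rad_superfluous (K : set (contra_lmod P)) :
  (forall k, K k -> forall i, in_rad (e i) (pcoord k i)) -> lmod_superfluous K.
Proof.
move=> Krad L subL KL; apply: (@rad_superfluous_seq L (enum I)) => // t.
have [k Kk [l Ll kl]] : [set x + y | x in K & y in L] t by rewrite KL.
exists l => // i; rewrite -kl addrK mem_enum; split=> //.
exact: Krad.
Qed.

End ProjsumContramodule.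

(** * Covers by irredundant families of generators *)

Section Covers.
Variables (R : rlTopRingType) (C : contramodType R).

(** The join of two subcontramodules is their sum as submodules, since an
    infinite combination over a two-element set is a finite sum. *)
Lemma contra_superfluous_lmod (D : contramodType R) (K : set D) :
  lmod_superfluous (K : set (contra_lmod D)) ->
  submod_closed (mem K : {pred contra_lmod D}) -> contra_superfluous K.
Proof.
move=> supK [K0 Klin] L subL KL; apply: supK; first exact: submod_closed_subcontra.
apply/seteqP; split=> // x _.
have [r [c [cKL ->]]] : subcontra_sum (fun b : bool => if b then K else L) x.
  by rewrite KL.
rewrite (@contrasum_fin R D bool) big_bool /=.
have [L0 Llin] := submod_closed_subcontra subL.
exists (r true *: (c true : contra_lmod D)).
  apply: set_mem; rewrite -[_ *: _]addr0; apply: Klin => //.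
  exact: mem_set (cKL true).
exists (r false *: (c false : contra_lmod D)) => //.
apply: set_mem; rewrite -[_ *: _]addr0; apply: Llin => //.
exact: mem_set (cKL false).
Qed.

(** A kernel element with a generating coordinate at [i] may be multiplied so that
    this coordinate becomes [e i]; the relation that it expresses would then
    make the generator [e i *: c i] redundant. *)
Lemma irredundant_projective_cover (I : finType) (e : I -> R)
    (ee : forall i, e i * e i = e i) (c : I -> contra_lmod C) :
  (forall i, local_ring (corner (ee i))) ->
  (forall b : contra_lmod C, exists t : I -> R, b = \sum_i (t i * e i) *: c i) ->
  (forall i (t : I -> R), e i *: c i <> \sum_(j | j != i) (t j * e j) *: c j) ->
  (exists (P : contramodType R) (p : P -> C), contra_projective_cover p) /\
  (exists (P : lmodType R) (p : {linear P -> contra_lmod C}),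
     lmod_projective_cover p).
Proof.
move=> loc span irr; pose p : projsum e -> C := lincomb c.
have hp : contra_morphism p := lincomb_morphism _.
have lp := contra_morphism_linear hp.
pose pL : {linear contra_lmod (projsum e) -> contra_lmod C} :=
  HB.pack (p : contra_lmod (projsum e) -> contra_lmod C)
          (GRing.isLinear.Build R _ _ _ _ lp).
have sp b : exists t, p t = b.
  have [t ->] := span b.
  have te i : t i * e i * e i = t i * e i by rewrite -mulrA ee.
  exists (projsum_of te); rewrite /p lincombE.
  by apply: eq_bigr => i _; rewrite projsum_ofE.
have supK : lmod_superfluous [set x | pL x = 0].
  apply: (rad_superfluous loc) => k /= pk i [r rk].
  have : pL (r *: k) = 0 by rewrite linearZ /= pk scaler0.
  rewrite /= /p lincombE (bigD1 i)//= pcoordZ rk => /eqP; rewrite addr_eq0 => /eqP.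
  pose t j := - pcoord (r *: k) j; move=> ic; apply: (irr i t).
  rewrite ic -sumrN; apply: eq_bigr => j _.
  by rewrite /t mulNr pcoordM scaleNr.
split.
- exists (projsum e), p; split=> //.
  + exact: surj_contra_epi.
  + exact: projsum_contra_projective.
  + apply: contra_superfluous_lmod; first exact: supK.
    split=> [|a x y /set_mem xK /set_mem yK]; apply: mem_set.
      exact: (linear0 pL).
    rewrite /contra_ker /=.
    by rewrite -[LHS]/(pL (a *: x + y)) linearP [pL x]xK [pL y]yK scaler0 addr0.
- exists (contra_lmod (projsum e)), pL; split=> //.
  + by move=> Q g h gh y; have [x <-] := sp y; exact: gh.
  + exact: projsum_lmod_projective.
Qed.

(** Drop redundant members one at a time; the cardinal bounds the number of
    steps. *)
Lemma irredundant_subfamily (X : choiceType) (e : X -> R) (c : X -> contra_lmod C) :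
  let span (F : {fset X}) := forall b : contra_lmod C,
    exists t : X -> R, b = \sum_(x <- F) (t x * e x) *: c x in
  forall F, span F -> exists2 G, span G & forall x, x \in G -> ~ span (G `\ x)%fset.
Proof.
move=> span F; have [n] := ubnP #|` F|.
elim: n F => // n IH F; rewrite ltnS => Fn sF.
have [[x [xF sFx]]|nF] := pselect (exists x, x \in F /\ span (F `\ x)%fset).
  by apply: IH sFx; apply: leq_trans Fn; rewrite [X in (_ < X)%N](cardfsD1 x) xF.
by exists F => // x xF sFx; apply: nF; exists x.
Qed.

(** A combination of the multiples [r y *: c] with coefficients [u y] is the
    multiple of [c] by the sum of the [u y * r y]. *)
Lemma cyclic_subcontramodule (c : contra_lmod C) :
  subcontramodule ([set r *: c | r in setT] : set C).
Proof.
move=> u; have [r rE] : {r : ([set r *: c | r in setT] : set C) -> R &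
    forall y, set_val y = r y *: c}.
  apply: (@choice _ _
    (fun (y : ([set r *: c | r in setT] : set C)) r => set_val y = r *: c)).
  by move=> [y yE]; have [r _ ry] := set_mem yE; exists r; exact: esym ry.
exists (tsum (fun y => u y * r y)) => //.
transitivity (contrasum (fsum_bind u (fun y => fin_fsum (fun _ : unit => r y)))
    (fun=> c : C)).
  by rewrite (@contrasum_fin R C unit) (big_pred1 tt) => // -[].
rewrite contrasum_bind; congr contrasum; apply/funext => y.
by rewrite (@contrasum_fin R C unit) (big_pred1 tt) => [|[]//]; rewrite rE.
Qed.

Lemma sum_idempotents_scale (Z : choiceType) (e : Z -> R) (ze : zero_convergent e)
    (ee : forall z, e z * e z = e z) (b : contra_lmod C) :
  tsum e = 1 -> contrasum (Fsum ze) (fun z => e z *: b) = b :> contra_lmod C.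
Proof.
move=> e1; pose v z : fsum R unit := fin_fsum (fun=> e z).
transitivity (contrasum (fsum_bind (Fsum ze) v) (fun=> b : C)).
  rewrite contrasum_bind; congr contrasum; apply/funext => z.
  by rewrite (@contrasum_fin R C unit) (big_pred1 tt) => // -[].
rewrite (@contrasum_fin R C unit) (big_pred1 tt) => [|[]//] /=.
rewrite (_ : tsum _ = 1) ?scale1r// -e1.
by congr tsum; apply/funext => z; rewrite ee.
Qed.

End Covers.

Theorem proposition9p9 (R : rlTopRingType) (hR : topologically_semiperfect R)
    (C : contramodType R) (hC : lattice_finite C) :
  (exists (P : contramodType R) (p : P -> C), contra_projective_cover p) /\
  (exists (P : lmodType R) (p : {linear P -> contra_lmod C}),
     lmod_projective_cover p).
Proof.
have [Z [e [ee [ze _ e1 loc]]]] := hR.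
pose X : choiceType := (contra_lmod C * Z)%type.
pose eX (x : X) := e x.2; pose c (x : X) : contra_lmod C := x.1.
pose D (x : X) : set C := [set r *: (eX x *: c x) | r in setT].
have [|F FC] := hC X D (fun x => @cyclic_subcontramodule _ _ _).
  apply/seteqP; split=> // b _.
  (* [b] is the combination of the [e z *: b] with coefficients [e z] *)
  exists (fsum_map (fun z => (b, z) : X) (Fsum ze)), (fun x => eX x *: c x).
  split=> [x|]; first by exists 1 => //; rewrite scale1r.
  by rewrite contrasum_map -[LHS](sum_idempotents_scale ze ee _ e1).
have sF : forall b : contra_lmod C,
    exists t : X -> R, b = \sum_(x <- F) (t x * eX x) *: c x.
  move=> b; have [r [d [dD ->]]] : subcontra_sum (fun x : F => D (val x)) b.
    by rewrite FC.
  have [s sE] : {s : F -> R & forall x, s x *: (eX (val x) *: c (val x)) = d x}.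
    apply: (@choice _ _ (fun (x : F) s => s *: (eX (val x) *: c (val x)) = d x)).
    by move=> x; have [s _ sE] := dD x; exists s.
  exists (fun x => if insub x is Some y then r y * s y else 0).
  rewrite big_seq_fsetE contrasum_fin; apply: eq_bigr => x _ /=.
  by rewrite valK -sE !scalerA.
have [G sG irrG] := irredundant_subfamily sF.
apply: (@irredundant_projective_cover _ _ G (fun x => eX (val x))
  (fun x => ee (val x).2) (fun x => c (val x))).
- by move=> i; exact: loc.
- move=> b; have [t ->] := sG b; exists (fun x => t (val x)).
  by rewrite big_seq_fsetE.
- move=> i t it; apply: (irrG (val i) (valP i)) => b; have [s ->] := sG b.
  pose t' x := if insub x is Some y then t y else 0.
  exists (fun x => s x + s (val i) * t' x).
  rewrite (big_fsetD1 (val i) (valP i)) /= -scalerA it.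
  have -> : \sum_(j | j != i) (t j * eX (val j)) *: c (val j) =
            \sum_(x <- (G `\ val i)%fset) (t' x * eX x) *: c x.
    rewrite (_ : (G `\ val i)%fset = [fset x in G | x != val i]%fset).
      rewrite -(big_fset_condE _ G) big_seq_fsetE.
      by apply: eq_bigr => j _; rewrite /t' valK.
    by apply/fsetP => x; rewrite !inE andbC.
  rewrite scaler_sumr -big_split; apply: eq_bigr => x _ /=.
  by rewrite scalerA mulrDl scalerDl mulrA addrC.
Qed.
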